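(* Assume that $$\mathbf{M}_2(S\circ T,a,c,g,\psi)\le\mathbf{M}_1(S,Ta,c,g,\psi)\quad\text{and}\quad\mathbf{H}_1(Ta,c,g,\psi)\le\mathbf{M}(T,a,c,g,\psi)$$ for every $T\in\mathcal{H}$, $S\in\mathcal{H}_1$, $a\in A$, $c\in C$, $g\in G$ and $\psi\in W$. If $0<q\le s\le t\le\infty$, then $$\mathfrak{M}^{\mathbf{H}_1-\mathbf{M}_1}_{((t;s),s)}(B,D)\circ\mathfrak{M}^{\mathbf{H}-\mathbf{M}}_{((s;q),q)}(A,B)\subseteq\mathfrak{M}^{\mathbf{H}-\mathbf{M}_2}_{((t;q),q)}(A,D);$$ that is, if $S$ is $\mathbf{H}_1$--$\mathbf{M}_1$-$((t;s),s)$-mixing and $T$ is $\mathbf{H}$--$\mathbf{M}$-$((s;q),q)$-mixing, then $S\circ T$ is $\mathbf{H}$--$\mathbf{M}_2$-$((t;q),q)$-mixing.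
   Context: $A,B,C,C_1,D$ are non-void sets; $G$ is a Banach space; $K,W$ are compact Hausdorff topological spaces; $\mathcal{H},\mathcal{H}_1,\mathcal{H}_2$ are non-void families of mappings from $A$ into $B$, from $B$ into $D$, and from $A$ into $D$, respectively. Given are maps $\mathbf{H}:A\times C\times G\times K\to\mathbb{R}$, $\mathbf{H}_1:B\times C_1\times G\times W\to\mathbb{R}$, $\mathbf{M}:\mathcal{H}\times A\times C\times G\times W\to\mathbb{R}$, $\mathbf{M}_1:\mathcal{H}_1\times B\times C_1\times G\times W\to\mathbb{R}$, $\mathbf{M}_2:\mathcal{H}_2\times A\times C\times G\times W\to\mathbb{R}$. For the assumed inequalities to make sense, $S\circ T\in\mathcal{H}_2$ whenever $T\in\mathcal{H}$, $S\in\mathcal{H}_1$, and $C\subseteq C_1$. Expressions $[\sum|\cdot|^p]^{1/p}$ with $p=\infty$ are read as suprema. For $0<q\le s\le\infty$ let $r$ be determined by $\frac1r+\frac1s=\frac1q$. For $T\in\mathcal{H}$, nonzero reals $\sigma_j$ and $a_j\in A$, $c_j\in C$, $g_j\in G$ set $$\mathfrak{m}^{\mathbf{M}}_{(s;q)}\left((\sigma_j,T,a_j,c_j,g_j,\psi)\right)_{j=1}^m=\inf\left[\sum_{j=1}^m|\tau_j|^r\right]^{1/r}\sup_{\psi\in W}\left[\sum_{j=1}^m\left|\frac{\sigma_j}{\tau_j}\right|^s|\mathbf{M}(T,a_j,c_j,g_j,\psi)|^s\right]^{1/s},$$ the infimum being over all families of nonzero numbers $\tau_1,\dots,\tau_m$.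 $T$ is $\mathbf{H}$--$\mathbf{M}$-$((s;q),q)$-mixing if there is $\delta\ge0$ with $$\mathfrak{m}^{\mathbf{M}}_{(s;q)}\left((\sigma_j,T,a_j,c_j,g_j,\psi)\right)_{j=1}^m\le\delta\sup_{\varphi\in K}\left[\sum_{j=1}^m|\sigma_j|^q|\mathbf{H}(a_j,c_j,g_j,\varphi)|^q\right]^{1/q}$$ for all $m\in\mathbb{N}$, nonzero $\sigma_j\in\mathbb{R}$, $a_j\in A$, $c_j\in C$, $g_j\in G$. The class of all such maps from $A$ into $B$ is $\mathfrak{M}^{\mathbf{H}-\mathbf{M}}_{((s;q),q)}(A,B)$. $\mathbf{H}_1$--$\mathbf{M}_1$-mixing (for $S\in\mathcal{H}_1$, with points $b_j\in B$, $c_j\in C_1$, $g_j\in G$, and with $\sup_{\psi\in W}$ and $\mathbf{H}_1(b_j,c_j,g_j,\psi)$ on the right-hand side) and $\mathbf{H}$--$\mathbf{M}_2$-mixing (for maps in $\mathcal{H}_2$, with $a_j\in A$, $c_j\in C$, $g_j\in G$ and $\mathbf{H}$ on the right-hand side) are defined in the same way, with $\mathbf{M}$ replaced by $\mathbf{M}_1$, $\mathbf{M}_2$ respectively, and with the indicated exponents.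
   Formalization: The two assumed inequalities are taken between absolute values, |M_2| ≤ |M_1| and |H_1| ≤ |M|; for signed real-valued maps the literal inequalities make the claim false (e.g. H = H_1 = M = M_1 = 0, M_2 = -1). *)

(* Defs.v *)
From HB Require Import structures.
From mathcomp Require Import all_boot all_order all_algebra.
From mathcomp Require Import all_classical all_reals all_analysis.

Set Implicit Arguments.
Unset Strict Implicit.
Unset Printing Implicit Defensive.

Import Order.TTheory GRing.Theory Num.Theory.
Import numFieldNormedType.Exports.

Local Open Scope classical_set_scope.
Local Open Scope ring_scope.

(* [\sum_j |x_j|^p]^{1/p} for 0 < p <= +oo, read as max_j |x_j| for p = +oo;
   the value at -oo is irrelevant. *)
Definition lp_sum (R : realType) (p : \bar R) (m : nat) (x : 'I_m -> R) : R :=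
  match p with
  | p0%:E => (\sum_(j < m) `|x j| `^ p0) `^ p0^-1
  | +oo%E => \big[Num.max/0]_(j < m) `|x j|
  | -oo%E => 0
  end.

(* Supremum in [0, +oo] of a family of nonnegative values.  No continuity or
   boundedness is assumed, so it may be +oo.  Adjoining 0 only affects the
   empty index type, where the supremum is 0 rather than -oo. *)
Definition nneg_sup (R : realType) (I : Type) (f : I -> R) : \bar R :=
  ereal_sup (0%E |` [set (f i)%:E | i in [set: I]]).

(* The solution r of 1/r + 1/s = 1/q, with the conventions 0^-1 = +oo and
   (+oo)^-1 = 0 of [inve]; in particular r = +oo when q = s. *)
Definition mixing_exponent (R : realType) (s q : \bar R) : \bar R :=
  (q^-1 - s^-1)^-1%E.

Lemma mixing_exponentP (R : realType) (s q : \bar R) :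
  (0 < q)%E -> (q <= s)%E ->
  (0 < mixing_exponent s q)%E /\
  ((mixing_exponent s q)^-1 + s^-1 = q^-1)%E.
Proof.
rewrite /mixing_exponent inveK => q0 qs.
have s0 : (0 < s)%E := lt_le_trans q0 qs.
have is0 : (0 <= s^-1)%E by rewrite inve_ge0 ltW.
have sfin : (s^-1 \is a fin_num)%E.
  by rewrite ge0_fin_numE// ltey inve_eqy gt_eqF.
have qfin : (q^-1 \is a fin_num)%E.
  by rewrite ge0_fin_numE ?inve_ge0 1?ltW// ltey inve_eqy gt_eqF.
have d0 : (0 <= q^-1 - s^-1)%E.
  by rewrite sube_ge0 ?sfin// lee_pV2// inE ltW.
split; last by rewrite subeK.
by rewrite lt_neqAle inve_ge0 d0 andbT eq_sym inve_eq0 lt_eqF// ltey_eq fin_numB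
  qfin sfin.
Qed.

(* m_{(s;q)}, written for an array [x j psi] standing for M(T,a_j,c_j,g_j,psi). *)
Definition mixing_quantity (R : realType) (W : Type) (s q : \bar R) (m : nat)
    (sigma : 'I_m -> R) (x : 'I_m -> W -> R) : \bar R :=
  ereal_inf
    [set ((lp_sum (mixing_exponent s q) tau)%:E *
          nneg_sup (fun psi : W =>
            lp_sum s (fun j => (`|sigma j / tau j| * `|x j psi|)%R)))%E
    | tau in [set tau : 'I_m -> R | forall j, tau j != 0]].

(* ((s;q),q)-mixing for a single map T, with N = M(T, ...).  *)
Definition is_mixing (R : realType) (A C G K W : Type) (s q : \bar R)
    (H : A -> C -> G -> K -> R) (N : A -> C -> G -> W -> R) : Prop :=
  exists2 delta : R, 0 <= delta &
    forall (m : nat) (sigma : 'I_m -> R)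
           (a : 'I_m -> A) (c : 'I_m -> C) (g : 'I_m -> G),
      (forall j, sigma j != 0) ->
      (mixing_quantity s q sigma (fun j psi => N (a j) (c j) (g j) psi)
       <= delta%:E *
          nneg_sup (fun phi : K =>
            lp_sum q (fun j =>
              (`|sigma j| * `|H (a j) (c j) (g j) phi|)%R)))%E.

(* The class of H-M-((s;q),q)-mixing maps, as a set of functions A -> B; M is
   only defined on the family F. *)
Definition mixing_class (R : realType) (A B C G K W : Type) (s q : \bar R)
    (F : set (A -> B)) (H : A -> C -> G -> K -> R)
    (M : F -> A -> C -> G -> W -> R) : set (A -> B) :=
  [set set_val T | T in [set T : F | is_mixing s q H (M T)]].

(* Main.v *)
(* If tau and rho are admissible for the mixing quantities of T and S, then
   tau * rho is admissible for that of S \o T; its norm is controlled by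
   Hoelder's inequality, since 1/r(t;q) = 1/r(s;q) + 1/r(t;s). *)
Require Import Defs.
From HB Require Import structures.
From mathcomp Require Import all_boot all_order all_algebra.
From mathcomp Require Import all_classical all_reals all_analysis.

Set Implicit Arguments.
Unset Strict Implicit.
Unset Printing Implicit Defensive.

Import Order.TTheory GRing.Theory Num.Theory.
Import numFieldNormedType.Exports.

Local Open Scope classical_set_scope.
Local Open Scope ring_scope.

Lemma powRVK (R : realType) (x p : R) :
  0 <= x -> p != 0 -> (x `^ p^-1) `^ p = x.
Proof. by move=> x0 p0; rewrite -powRrM mulVf// powRr1. Qed.

(** Induction on the list: the two-term inequality [hoelder2] is applied to the head pair and to the
    pair of norms of the tail, whose powers give back the tail sums by [powRVK]. *)
Lemma hoelder_sum (R : realType) (I : Type) (s : seq I) (f g : I -> R)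
    (p q : R) :
  (forall i, 0 <= f i) -> (forall i, 0 <= g i) ->
  0 < p -> 0 < q -> p^-1 + q^-1 = 1 ->
  \sum_(i <- s) f i * g i <=
  (\sum_(i <- s) f i `^ p) `^ p^-1 * (\sum_(i <- s) g i `^ q) `^ q^-1.
Proof.
move=> f0 g0 p0 q0 pq; elim: s => [|i s IHs].
  by rewrite !big_nil mulr_ge0// powR_ge0.
rewrite !big_cons; set X := \sum_(j <- s) f j `^ p in IHs *.
set Y := \sum_(j <- s) g j `^ q in IHs *.
have X0 : 0 <= X by apply: sumr_ge0 => j _; exact: powR_ge0.
have Y0 : 0 <= Y by apply: sumr_ge0 => j _; exact: powR_ge0.
clearbody X Y; apply: le_trans (lerD (lexx _) IHs) _.
apply: le_trans (hoelder2 _ _ _ _ p0 q0 pq) _; rewrite ?powR_ge0//.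
rewrite (powRVK X0); last by rewrite gt_eqF.
by rewrite (powRVK Y0)// gt_eqF.
Qed.

Lemma lp_sum_ge0 (R : realType) (p : \bar R) (m : nat) (x : 'I_m -> R) :
  0 <= lp_sum p x.
Proof.
case: p => [p| |] //=; first exact: powR_ge0.
exact: bigmax_ge_id.
Qed.

Lemma lp_sum_gt0 (R : realType) (p : \bar R) (m : nat) (x : 'I_m -> R)
    (j : 'I_m) :
  (0 < p)%E -> x j != 0 -> 0 < lp_sum p x.
Proof.
case: p => [p| |] //= p0 xj; last first.
  apply: (@lt_le_trans _ _ `|x j|); first by rewrite normr_gt0.
  exact: (le_bigmax _ (fun j => `|x j|)).
rewrite powR_gt0// (bigD1 j)//= ltr_wpDr ?powR_gt0 ?normr_gt0//.
by apply: sumr_ge0 => i _; exact: powR_ge0.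
Qed.

Lemma lp_sum_ord0 (R : realType) (p : \bar R) (x : 'I_0 -> R) :
  (0 < p)%E -> lp_sum p x = 0.
Proof.
case: p => [p| |] //=; rewrite big_ord0// lte_fin => p0.
by rewrite powR0// invr_eq0 gt_eqF.
Qed.

Lemma le_lp_sum (R : realType) (p : \bar R) (m : nat) (x y : 'I_m -> R) :
  (0 < p)%E -> (forall j, `|x j| <= `|y j|) -> lp_sum p x <= lp_sum p y.
Proof.
move=> + xy; case: p => [p p0|_|//]; rewrite /lp_sum.
  rewrite lte_fin in p0.
  apply: ge0_ler_powR; rewrite ?nnegrE.
  - by rewrite invr_ge0 ltW.
  - by apply: sumr_ge0 => j _; exact: powR_ge0.
  - by apply: sumr_ge0 => j _; exact: powR_ge0.
  - by apply: ler_sum => j _; apply: ge0_ler_powR; rewrite ?nnegrE// ltW.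
by apply: le_bigmax2 => j _; exact: xy.
Qed.

Lemma lp_sumZ_le (R : realType) (p : \bar R) (m : nat) (k : R)
    (x : 'I_m -> R) :
  (0 < p)%E -> lp_sum p (fun j => k * x j) <= `|k| * lp_sum p x.
Proof.
case: p => [p| |] //=; rewrite ?lte_fin => p0.
  under eq_bigr do rewrite normrM powRM//.
  rewrite -mulr_sumr powRM ?powR_ge0//; last first.
    by apply: sumr_ge0 => j _; exact: powR_ge0.
  by rewrite -powRrM mulfV ?gt_eqF// powRr1.
apply: bigmax_le => [|j _]; first by rewrite mulr_ge0// bigmax_ge_id.
by rewrite normrM ler_wpM2l// (le_bigmax _ (fun j => `|x j|)).
Qed.


(** If an exponent is infinite, its factor is bounded by its maximum and homogeneity suffices. If
    both are finite, the classical inequality for [|x j|]^ t[and]|y j| [^ t], with [t] the value of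
    [r], has conjugate exponents [p / t] and [q / t]; a [t]-th root finishes. *)
Lemma lp_sum_hoelder (R : realType) (p q r : \bar R) (m : nat)
    (x y : 'I_m -> R) :
  (0 < p)%E -> (0 < q)%E -> (p^-1 + q^-1 = r^-1)%E ->
  lp_sum r (fun j => x j * y j) <= lp_sum p x * lp_sum q y.
Proof.
have hoelder_oo (p' : \bar R) (u v : 'I_m -> R) : (0 < p')%E ->
    lp_sum p' (fun j => u j * v j) <= lp_sum +oo u * lp_sum p' v.
  move=> p'0; set k := lp_sum +oo u.
  have k0 : 0 <= k := lp_sum_ge0 +oo u.
  rewrite -[k in leRHS]ger0_norm//; apply: le_trans (lp_sumZ_le k v p'0).
  apply: le_lp_sum => // j; rewrite !normrM ler_wpM2r// [leRHS]ger0_norm//.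
  exact: (le_bigmax _ (fun j => `|u j|)).
case: p => [p| |] // p0; last first.
  (* Here [p^-1 = 0], and since inversion is injective, [r = q]. *)
  by move=> q0; rewrite invey add0e => /(can_inj inveK) <-; exact: hoelder_oo.
case: q => [q| |] // q0; last first.
  rewrite invey adde0 => /(can_inj inveK) <-; rewrite mulrC.
  by under eq_fun do rewrite mulrC; exact: hoelder_oo.
rewrite !lte_fin in p0 q0.
move=> pqr; have -> : r = ((p^-1 + q^-1)^-1)%:E.
  apply: (can_inj inveK); rewrite -pqr !inver !gt_eqF ?invr_gt0 ?addr_gt0 ?invr_gt0//.
  by rewrite invrK.
set t := (p^-1 + q^-1)^-1 => /=.
have t0 : 0 < t by rewrite invr_gt0 addr_gt0 ?invr_gt0.
have powRpt (z a : R) : z `^ a = (z `^ t) `^ (a / t).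
  by rewrite -powRrM mulrCA mulfV ?gt_eqF// mulr1.
have H := @hoelder_sum R _ (index_enum 'I_m) (fun j => `|x j| `^ t)
  (fun j => `|y j| `^ t) (p / t) (q / t).
under eq_bigr do rewrite normrM powRM//.
under [X in X `^ p^-1]eq_bigr do rewrite powRpt.
under [X in X `^ q^-1]eq_bigr do rewrite powRpt.
(* Splitting off [t^-1] from both outer exponents exposes a common [t]-th root, which can then be
   removed by monotonicity. *)
have -> : p^-1 = (p / t)^-1 * t^-1 by rewrite invf_div mulrAC mulfV ?mul1r// gt_eqF.
have -> : q^-1 = (q / t)^-1 * t^-1 by rewrite invf_div mulrAC mulfV ?mul1r// gt_eqF.
rewrite [X in _ <= X * _]powRrM [X in _ <= _ * X]powRrM -powRM; last 2 first.
- exact: powR_ge0.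
- exact: powR_ge0.
apply: ge0_ler_powR.
- by rewrite invr_ge0 ltW.
- by rewrite nnegrE; apply: sumr_ge0 => j _; rewrite mulr_ge0// powR_ge0.
- by rewrite nnegrE mulr_ge0// powR_ge0.
apply: H => [j|j|||]; rewrite ?powR_ge0 ?divr_gt0//.
by rewrite !invf_div -mulrDr mulVf// gt_eqF// addr_gt0 ?invr_gt0.
Qed.

Lemma nneg_sup_ge0 (R : realType) (I : Type) (f : I -> R) :
  (0 <= nneg_sup f)%E.
Proof. by apply: ereal_sup_ubound; left. Qed.

Lemma le_nneg_sup (R : realType) (I : Type) (f g : I -> R) :
  (forall i, f i <= g i) -> (nneg_sup f <= nneg_sup g)%E.
Proof.
move=> fg; apply: ge_ereal_sup => _ [->|[i _ <-]]; first exact: nneg_sup_ge0.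
apply: (@le_trans _ _ (g i)%:E); first by rewrite lee_fin.
by apply: ereal_sup_ubound; right; exists i.
Qed.

Lemma mixing_quantity_ord0 (R : realType) (W : Type) (s q : \bar R)
    (sigma : 'I_0 -> R) (x : 'I_0 -> W -> R) :
  (0 < q)%E -> (q <= s)%E -> (mixing_quantity s q sigma x <= 0)%E.
Proof.
move=> q0 qs; apply: ereal_inf_lbound; exists (fun=> 1); first by case.
by rewrite lp_sum_ord0 ?mul0e//; have [] := mixing_exponentP q0 qs.
Qed.

(** The differences of inverses telescope; cancelling [s^-1] in the extended reals is legitimate
    because [s > 0] makes it finite. *)
Lemma mixing_exponentD (R : realType) (q s t : \bar R) :
  (0 < q)%E -> (q <= s)%E -> (s <= t)%E ->
  ((mixing_exponent s q)^-1 + (mixing_exponent t s)^-1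
    = (mixing_exponent t q)^-1)%E.
Proof.
move=> q0 qs st; rewrite /mixing_exponent !inveK.
have s0 : (0 < s)%E := lt_le_trans q0 qs.
have sfin : (s^-1 \is a fin_num)%E.
  by rewrite fin_numV ?gt_eqF// (lt_trans _ s0).
by rewrite addeA subeK.
Qed.

(** With [tau] fixed and only [rho] varying, the quotients [sigma j / tau j] become the weights of
    the inner mixing quantity. *)
Lemma mixing_quantity_mul (R : realType) (W : Type) (q s t : \bar R) (m : nat)
    (sigma tau : 'I_m -> R) (x y : 'I_m -> W -> R) :
  (0 < q)%E -> (q <= s)%E -> (s <= t)%E ->
  (forall j, tau j != 0) -> (forall j psi, `|y j psi| <= `|x j psi|) ->
  (mixing_quantity t q sigma y <= (lp_sum (mixing_exponent s q) tau)%:E *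
    mixing_quantity t s (fun j => sigma j / tau j)%R x)%E.
Proof.
(* The empty family is separate: there the norm of [tau] is 0 and cannot be divided by. *)
case: m sigma tau x y => [|m] sigma tau x y q0 qs st tau0 yx.
  rewrite lp_sum_ord0 ?mul0e; last by have [] := mixing_exponentP q0 qs.
  exact/mixing_quantity_ord0/le_trans/st.
have s0 := lt_le_trans q0 qs; have t0 := lt_le_trans s0 st.
have [r0 _] := mixing_exponentP q0 qs; have [r'0 _] := mixing_exponentP s0 st.
have k0 := lp_sum_gt0 r0 (tau0 ord0).
(* Moving the positive factor to the left leaves a bare infimum on the right, so it is enough to
   treat each [rho]. *)
rewrite -lee_pdivrMl//; apply: le_ereal_inf_tmp => _ [rho rho0 <-].
rewrite lee_pdivrMl// muleA -EFinM.
apply: (@le_trans _ _ ((lp_sum (mixing_exponent t q)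
    (fun j => tau j * rho j)%R)%:E * nneg_sup (fun psi : W =>
    lp_sum t (fun j => (`|sigma j / (tau j * rho j)| * `|y j psi|)%R)))%E).
  apply: ereal_inf_lbound; exists (fun j => tau j * rho j) => //= j.
  by rewrite mulf_neq0// rho0.
apply: lee_pmul; rewrite ?lee_fin ?lp_sum_ge0 ?nneg_sup_ge0//.
  exact/lp_sum_hoelder/mixing_exponentD.
apply: le_nneg_sup => psi; apply: le_lp_sum => // j.
(* The weights agree: [sigma / (tau * rho) = (sigma / tau) / rho]. *)
by rewrite invfM mulrA !normrM !normr_id ler_wpM2l.
Qed.

(** The supremum over [W] bounding the mixing quantity of the outer map, taken at the points
    [f (a j)] with weights [sigma j / tau j], is dominated through [N] by the supremum that [tau]
    contributes to the mixing quantity of [f]. *)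
Lemma is_mixing_comp (R : realType) (A B C C1 G K W : Type) (f : A -> B)
    (i : C -> C1) (H : A -> C -> G -> K -> R) (N N2 : A -> C -> G -> W -> R)
    (H1 N1 : B -> C1 -> G -> W -> R) (q s t : \bar R) :
  (0 < q)%E -> (q <= s)%E -> (s <= t)%E ->
  (forall a c g psi, `|N2 a c g psi| <= `|N1 (f a) (i c) g psi|) ->
  (forall a c g psi, `|H1 (f a) (i c) g psi| <= `|N a c g psi|) ->
  is_mixing t s H1 N1 -> is_mixing s q H N -> is_mixing t q H N2.
Proof.
move=> q0 qs st N21 H1N [d1 d10 mix1] [d2 d20 mix2].
have s0 := lt_le_trans q0 qs.
(* [d1 + 1] rather than [d1]: a positive factor passes through the infimum. *)
have d1p : 0 < d1 + 1 by rewrite ltr_wpDl.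
exists ((d1 + 1) * d2); first by rewrite mulr_ge0// ltW.
move=> m sigma a c g sigma0; rewrite EFinM -muleA -lee_pdivrMl//.
apply: le_trans (mix2 m sigma a c g sigma0).
(* The infimum in the mixing quantity of [f] need not be attained, so the bound is proved for every
   admissible [tau]. *)
apply: le_ereal_inf_tmp => _ [tau tau0 <-]; rewrite lee_pdivrMl//.
apply: le_trans (mixing_quantity_mul sigma q0 qs st tau0
  (fun j psi => N21 (a j) (c j) (g j) psi)) _.
rewrite [leRHS]muleCA lee_wpmul2l ?lee_fin ?lp_sum_ge0//.
(* The weights [sigma j / tau j] are nonzero, hence allowed in the mixing inequality of the outer
   map. *)
apply: le_trans (mix1 m _ (f \o a) (i \o c) g _) _.
  by move=> j; rewrite mulf_neq0 ?invr_neq0// tau0.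
apply: lee_pmul; rewrite ?lee_fin ?lerDl ?nneg_sup_ge0//.
apply: le_nneg_sup => psi; apply: le_lp_sum => // j.
by rewrite !normrM !normr_id ler_wpM2l//; exact: H1N.
Qed.

(** The two domination hypotheses compare absolute values, the only form in which these maps enter
    the mixing quantities. The inclusion of [C] in [C1] is [set_val], and [SigSub] carries the proof
    that a composite lies in [F2], the domain of [M2]. *)
Theorem proposition15 (R : realType)
  (A B D C1 : Type) (C : set C1)
  (A_neq0 : [set: A] !=set0) (B_neq0 : [set: B] !=set0)
  (D_neq0 : [set: D] !=set0) (C1_neq0 : [set: C1] !=set0) (C_neq0 : C !=set0)
  (G : completeNormedModType R)
  (K W : topologicalType)
  (K_compact : compact [set: K]) (K_hausdorff : hausdorff_space K)
  (W_compact : compact [set: W]) (W_hausdorff : hausdorff_space W)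
  (F : set (A -> B)) (F1 : set (B -> D)) (F2 : set (A -> D))
  (F_neq0 : F !=set0) (F1_neq0 : F1 !=set0) (F2_neq0 : F2 !=set0)
  (comp_F2 : forall (T : F) (S : F1), set_val S \o set_val T \in F2)
  (H : A -> C -> G -> K -> R)
  (H1 : B -> C1 -> G -> W -> R)
  (M : F -> A -> C -> G -> W -> R)
  (M1 : F1 -> B -> C1 -> G -> W -> R)
  (M2 : F2 -> A -> C -> G -> W -> R)
  (M2_le_M1 : forall (T : F) (S : F1) (a : A) (c : C) (g : G) (psi : W),
    `|M2 (SigSub (comp_F2 T S)) a c g psi|
      <= `|M1 S (set_val T a) (set_val c) g psi|)
  (H1_le_M : forall (T : F) (a : A) (c : C) (g : G) (psi : W),
    `|H1 (set_val T a) (set_val c) g psi| <= `|M T a c g psi|)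
  (q s t : \bar R) (q_gt0 : (0 < q)%E) (q_le_s : (q <= s)%E)
  (s_le_t : (s <= t)%E) :
  [set S \o T | S in mixing_class t s H1 M1 & T in mixing_class s q H M]
    `<=` mixing_class t q H M2.
Proof.
move=> _ [_ [S mixS <-] [_ [T mixT <-] <-]].
exists (SigSub (comp_F2 T S)) => //=.
exact: (is_mixing_comp q_gt0 q_le_s s_le_t (M2_le_M1 T S) (H1_le_M T) mixS mixT).
Qed.
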